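(* Let $n\ge1$. For any compact set $S$ in the forward positive cone $\mathcal{P}_n^+\subset H_2(\widetilde M_n;\mathbb{R})$, the set $$\mathcal{H}(S)=\{A\in\mathcal{H}_n : H_A\cap S\ne\emptyset\}$$ is finite.
   Context: $\widetilde M_n=\mathbb{C}\mathrm{P}^2\#n\overline{\mathbb{C}\mathrm{P}}^2$, $L$ is the class of a line and $E_1,\dots,E_n$ are the exceptional classes, so $L^2=1$, $E_i^2=-1$ and distinct basis elements are orthogonal for the intersection form. Cohomology classes are identified with homology classes by Poincaré duality, so $\omega(A)=\omega\cdot A$. $K_n=-3L+\sum_iE_i$ is the canonical class. $\mathcal{P}_n^+=\{\omega\in H_2(\widetilde M_n;\mathbb{R}) : \omega^2>0,\ \omega\cdot L>0\}$. $\mathcal{H}_n\subset H_2(\widetilde M_n;\mathbb{Z})$ is the set of integral classes $A=a_0L-\sum_{i=1}^na_iE_i$ such that $a_i\ge0$ for $i=0,\ldots,n$; $A^2=a_0^2-\sum_{i\ge1}a_i^2<0$; and $-2\le A^2+K_n\cdot A$. For $A\in\mathcal{H}_n$, $H_A=\{\omega : \omega\cdot A=0\}$. *)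

(* Defs.v *)
From mathcomp Require Import all_boot all_order all_algebra.
From mathcomp Require Import all_classical all_reals all_analysis.
Import Order.TTheory GRing.Theory Num.Theory.
Import numFieldNormedType.Exports.

Set Implicit Arguments.
Unset Strict Implicit.
Unset Printing Implicit Defensive.

Local Open Scope classical_set_scope.
Local Open Scope ring_scope.

(* H_2(CP^2 # n \bar{CP}^2; R) for R = int or a real field, given by its
   intersection lattice: a class is its row of coordinates in the basis
   L, E_1, ..., E_n, with L at index 0.  Thus x is x_0 L + \sum_i x_i E_i; the
   minus signs in A = a_0 L - \sum_i a_i E_i are not built into the
   coordinates. *)
Notation H2 R n := ('rV[R]_n.+1) (only parsing).

Definition lineL (R : comNzRingType) (n : nat) : H2 R n := delta_mx 0 ord0.

(* The index i : 'I_n counts from 0, so excE R i is E_(i+1). *)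
Definition excE (R : comNzRingType) (n : nat) (i : 'I_n) : H2 R n :=
  delta_mx 0 (lift ord0 i).

Arguments lineL : clear implicits.
Arguments excE R {n} i.

Definition intersection (R : comNzRingType) (n : nat) (x y : H2 R n) : R :=
  x 0 ord0 * y 0 ord0
  - \sum_(i < n) x 0 (lift ord0 i) * y 0 (lift ord0 i).

Notation "x '·' y" := (intersection x y)
  (at level 40, left associativity) : ring_scope.

Lemma intersectionLL (R : comNzRingType) (n : nat) :
  lineL R n · lineL R n = 1.
Proof.
rewrite /intersection /lineL !mxE /= mulr1 big1 ?subr0 // => i _.
by rewrite !mxE /= mul0r.
Qed.

Lemma intersectionLE (R : comNzRingType) (n : nat) (i : 'I_n) :
  lineL R n · excE R i = 0.
Proof.
rewrite /intersection /lineL /excE !mxE /= mulr0 sub0r big1 ?oppr0 // => j _.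
by rewrite !mxE /= mul0r.
Qed.

Lemma intersectionEE (R : comNzRingType) (n : nat) (i j : 'I_n) :
  excE R i · excE R j = if i == j then -1 else 0.
Proof.
rewrite /intersection /excE !mxE /= mulr0 sub0r (bigD1 i) //= !mxE !eqxx mul1r.
rewrite (inj_eq lift_inj) big1 => [|k ki].
  by rewrite addr0; case: (i == j); rewrite ?oppr0.
by rewrite !mxE (inj_eq lift_inj) (negPf ki) mul0r.
Qed.

Definition canonicalK (n : nat) : H2 int n :=
  - (lineL int n *+ 3) + \sum_(i < n) excE int i.

Definition forward_positive_cone (R : realType) (n : nat) : set (H2 R n) :=
  [set w | 0 < w · w /\ 0 < w · lineL R n].

Arguments forward_positive_cone : clear implicits.

Definition calH (n : nat) : set (H2 int n) :=
  [set A | exists (a0 : int) (a : 'I_n -> int),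
    [/\ A = a0 *: lineL int n - \sum_(i < n) a i *: excE int i,
        0 <= a0, (forall i, 0 <= a i),
        A · A < 0 &
        -2 <= A · A + canonicalK n · A]].

Arguments calH : clear implicits.

Definition realclass (R : realType) (n : nat) (A : H2 int n) : H2 R n :=
  map_mx intr A.

Arguments realclass R {n} A.

Definition wallH (R : realType) (n : nat) (A : H2 int n) : set (H2 R n) :=
  [set w | w · realclass R A = 0].

Arguments wallH R {n} A.

Definition calH_meeting (R : realType) (n : nat) (S : set (H2 R n)) :
    set (H2 int n) :=
  [set A | calH n A /\ wallH R A `&` S !=set0].

(* Main.v *)
(* Write q for the intersection form.  By compactness w_0^2 <= C q(w) on S.  If
   w lies in S and on the wall of A, a quantitative Cauchy-Schwarz inequality
   turns this into a_0^2 <= - C q(A), i.e. \sum_i a_i^2 <= - (C + 1) q(A).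
   The condition q(A) + K A >= -2 with a_0 >= 0 gives - q(A) <= 2 + \sum_i a_i,
   which is linear in the a_i, so the a_i are bounded. *)

Require Import Defs.
From mathcomp Require Import all_boot all_order all_algebra.
From mathcomp Require Import all_classical all_reals all_analysis.
From mathcomp Require Import ring lra.
Import Order.TTheory GRing.Theory Num.Theory.
Import numFieldNormedType.Exports.
Local Open Scope classical_set_scope.
Local Open Scope ring_scope.

(** Such a row is recovered by [decode] from the sign and the absolute value of each entry, and
    these data range over a finite type. *)
Lemma finite_bounded_row (n N : nat) :
  finite_set [set A : 'rV[int]_n | forall i, (`|A 0%R i| <= N)%N].
Proof.
pose decode (f : {ffun 'I_n -> bool * 'I_N.+1}) : 'rV[int]_n :=
  \row_i ((-1) ^+ (f i).1 * ((f i).2 : nat)%:Z).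
apply: (sub_finite_set _ (finite_image decode (finite_finset (X := setT)))).
move=> A /= AN; exists [ffun i => (A 0 i < 0, inord `|A 0%R i|%N)] => //.
apply/rowP => i; rewrite mxE ffunE /= inordK ?ltnS ?AN //.
by rewrite [RHS]intEsign.
Qed.

Lemma canonicalK_intersection (n : nat) (A : H2 int n) :
  canonicalK n · A = - 3 * A 0 ord0 - \sum_(i < n) A 0 (lift ord0 i).
Proof.
have K0 : canonicalK n 0 ord0 = -3.
  rewrite /canonicalK mxE summxE big1 ?addr0 => [|i _]; last first.
    by rewrite mxE.
  by rewrite mxE mulmxnE mxE.
have K1 i : canonicalK n 0 (lift ord0 i) = 1.
  rewrite /canonicalK mxE summxE (bigD1 i) //= big1 => [|j ji].
    by rewrite mxE mulmxnE !mxE !eqxx /= mul0rn oppr0 add0r addr0.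
  by rewrite mxE (inj_eq lift_inj) eq_sym (negPf ji).
rewrite /intersection K0; congr (_ - _).
by apply: eq_bigr => i _; rewrite K1 mul1r.
Qed.

Lemma intersection_self_le (R : realType) (n : nat) (w : H2 R n) :
  w · w <= w 0 ord0 ^+ 2.
Proof.
rewrite /intersection -expr2 gerBl sumr_ge0 // => i _.
by rewrite -expr2 sqr_ge0.
Qed.

Lemma continuous_intersection_self (R : realType) (n : nat) :
  continuous (fun w : H2 R n => w · w).
Proof.
have csqr i : continuous (fun w : H2 R n => w 0 i * w 0 i).
  move=> w; exact: (@continuousM _ _ (fun w : H2 R n => w 0 i)
    (fun w : H2 R n => w 0 i) w (@coord_continuous _ _ _ _ _ _)
    (@coord_continuous _ _ _ _ _ _)).
move=> w; apply: (@continuousB R R _ (fun w : H2 R n => w 0 ord0 * w 0 ord0)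
  (fun w : H2 R n => \sum_(i < n) w 0 (lift ord0 i) * w 0 (lift ord0 i))).
  exact: csqr.
apply: (continuous_big (op := +%R)) => [|i _]; last exact: csqr.
exact: add_continuous.
Qed.

(** The quotient [g] of w_0^2 by q(w) is continuous on S because q > 0 there, so its image is
    compact, hence bounded. *)
Lemma compact_cone_bound (R : realType) (n : nat) (S : set (H2 R n)) :
  compact S -> S `<=` forward_positive_cone R n ->
  exists2 C : R, 0 < C & forall w, S w -> w 0 ord0 ^+ 2 <= C * (w · w).
Proof.
move=> cS SP; pose g (w : H2 R n) := w 0 ord0 ^+ 2 * (w · w)^-1.
have /compact_bounded[M [_ gM]] : compact (g @` S).
  apply: continuous_compact cS; apply: continuous_in_subspaceT => w.
  rewrite inE => /SP[w2 _]; apply: (@continuousM R (H2 R n)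
    (fun w => w 0 ord0 ^+ 2) (fun w => (w · w)^-1) w).
    apply: (@continuous_comp _ _ _ (fun w : H2 R n => w 0 ord0) (@GRing.exp R ^~ 2%N)).
      exact: coord_continuous.
    exact: exprn_continuous.
  by apply: continuousV; [rewrite gt_eqF|apply: continuous_intersection_self].
(* [gM] accepts only bounds strictly above [M], which may be negative; this one is also positive. *)
exists (`|M| + 1); first by rewrite ltr_wpDl.
move=> w Sw; have [w2 _] := SP _ Sw.
rewrite -ler_pdivrMr //; apply: le_trans (ler_norm _) _.
by apply: (gM (`|M| + 1)); [rewrite ltr_pwDr // ler_norm|exists w].
Qed.

(* Expand the squares in [0 <= \sum_i (a0 w_i - w0 a_i)^2]. *)
Lemma wall_gap (R : realType) (n : nat) (w a : H2 R n) (C : R) :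
  0 < C -> 0 < w · w -> w 0 ord0 ^+ 2 <= C * (w · w) -> w · a = 0 ->
  a 0 ord0 ^+ 2 <= C * - (a · a).
Proof.
move=> C0 w2 wC wa.
have w02 : 0 < w 0 ord0 ^+ 2 by exact: lt_le_trans w2 (intersection_self_le _ _ _).
have : 0 <= \sum_(i < n) (a 0 ord0 * w 0 (lift ord0 i) -
                          w 0 ord0 * a 0 (lift ord0 i)) ^+ 2.
  by apply: sumr_ge0 => i _; rewrite sqr_ge0.
have -> : \sum_(i < n) (a 0 ord0 * w 0 (lift ord0 i) -
                        w 0 ord0 * a 0 (lift ord0 i)) ^+ 2 =
   - (a 0 ord0 ^+ 2 * (w · w)) + 2 * a 0 ord0 * w 0 ord0 * (w · a)
   - w 0 ord0 ^+ 2 * (a · a).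
  rewrite /intersection.
  rewrite (eq_bigr (fun i => a 0 ord0 ^+ 2 * (w 0 (lift ord0 i) * w 0 (lift ord0 i))
   - 2 * a 0 ord0 * w 0 ord0 * (w 0 (lift ord0 i) * a 0 (lift ord0 i))
   + w 0 ord0 ^+ 2 * (a 0 (lift ord0 i) * a 0 (lift ord0 i)))); last first.
    by move=> i _; ring.
  rewrite big_split sumrB -!mulr_sumr /=; ring.
rewrite wa mulr0 addr0 => h.
have a2 : 0 <= - (a · a).
  by rewrite -(pmulr_rge0 _ w02); have := mulr_ge0 (sqr_ge0 (a 0 ord0)) (ltW w2); lra.
(* a_0^2 q(w) <= - w_0^2 q(a) <= - C q(w) q(a), the second step using [a2]; then q(w) > 0
   cancels. *)
rewrite -(ler_pM2r w2); have := ler_wpM2r a2 wC; lra.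
Qed.

Lemma calH_self_intersection (n : nat) (A : H2 int n) : calH n A ->
  - (A · A) <= 2 - \sum_(i < n) A 0 (lift ord0 i).
Proof.
case=> a0 [a [defA a0_ge0 _ _ +]].
have A0 : A 0 ord0 = a0.
  rewrite defA !mxE summxE big1 => [|i _]; first by rewrite subr0 mulr1.
  by rewrite !mxE mulr0.
rewrite canonicalK_intersection A0 => hK; lra.
Qed.

Lemma realclass_intersection (R : realType) (n : nat) (A B : H2 int n) :
  realclass R A · realclass R B = (A · B)%:~R.
Proof.
rewrite /intersection /realclass !mxE rmorphB rmorphM /= rmorph_sum /=.
by congr (_ - _); apply: eq_bigr => i _; rewrite !mxE rmorphM.
Qed.

Lemma wall_calH_bound (R : realType) (n : nat) (w : H2 R n) (A : H2 int n)
    (C : R) :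
  0 < C -> 0 < w · w -> w 0 ord0 ^+ 2 <= C * (w · w) ->
  calH n A -> wallH R A w ->
  forall i, (A 0 i)%:~R ^+ 2 <= 4 * (C + 1) + n%:R * (C + 1) ^+ 2.
Proof.
move=> C0 w2 wC /calH_self_intersection hA /(wall_gap _ _ _ _ _ C0 w2 wC) gap.
set Y := \sum_(i < n) (A 0 (lift ord0 i))%:~R ^+ 2 : R.
have hq : (A · A)%:~R = (A 0 ord0)%:~R ^+ 2 - Y.
  rewrite /intersection rmorphB rmorphM rmorph_sum -expr2; congr (_ - _).
  by apply: eq_bigr => i _; rewrite rmorphM expr2.
have {}hA : Y - (A 0 ord0)%:~R ^+ 2 <=
    2 - \sum_(i < n) (A 0 (lift ord0 i))%:~R :> R.
  rewrite -opprB -hq -rmorph_sum -rmorphN.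
  by move: hA; rewrite -(ler_int R) (rmorphB _ 2).
rewrite realclass_intersection hq mxE in gap.
have D0 : 0 < C + 1 by rewrite ltr_wpDl ?ltW.
(* AM-GM: [- y <= y^2 / (2 D) + D / 2] with [D = C + 1], summed and scaled. *)
have amgm : - (2 * (C + 1)) * \sum_(i < n) (A 0 (lift ord0 i))%:~R <=
    Y + n%:R * (C + 1) ^+ 2.
  have -> : n%:R * (C + 1) ^+ 2 = \sum_(i < n) (C + 1) ^+ 2.
    by rewrite sumr_const card_ord mulr_natl.
  rewrite mulr_sumr -big_split /=.
  apply: ler_sum => i _.
  have := sqr_ge0 ((A 0 (lift ord0 i))%:~R + (C + 1) : R); lra.
(* [gap] rearranges to Y <= D (Y - a_0^2) with D = C + 1. Twice [hA] scaled by D then bounds 2 Y,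
   and [amgm] costs only one Y on the right. *)
have YD : Y <= 4 * (C + 1) + n%:R * (C + 1) ^+ 2.
  have := ler_wpM2l (ltW D0) hA; lra.
move=> i; apply: le_trans YD.
have Yi j : (A 0 (lift ord0 j))%:~R ^+ 2 <= Y.
  rewrite /Y (bigD1 j) //= lerDl sumr_ge0 // => k _; exact: sqr_ge0.
case: (unliftP ord0 i) => [j ->|->] //.
(* For the L coordinate, [gap] gives C (Y - a_0^2) >= a_0^2 >= 0, so a_0^2 <= Y. *)
have : 0 <= C * ((A 0 ord0)%:~R ^+ 2 : R) by rewrite mulr_ge0 ?sqr_ge0 ?ltW.
move=> h; rewrite -subr_ge0 -(pmulr_rge0 _ C0); have := sqr_ge0 ((A 0 ord0)%:~R : R); lra.
Qed.

Theorem proposition5p11 (R : realType) (n : nat) (hn : (1 <= n)%N)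
    (S : set (H2 R n)) (cS : compact S)
    (SP : S `<=` forward_positive_cone R n) :
  finite_set (calH_meeting S).
Proof.
have [C C0 SC] := compact_cone_bound _ _ _ cS SP.
pose M := 4 * (C + 1) + n%:R * (C + 1) ^+ 2.
apply: (sub_finite_set _ (finite_bounded_row n.+1 (Num.bound M))).
move=> A [hA [w [wA Sw]]] i /=; have [w2 _] := SP _ Sw.
have Mi := wall_calH_bound _ _ _ _ _ C0 w2 (SC _ Sw) hA wA i.
rewrite -(ler_nat R) ltW //; apply: le_lt_trans (archi_boundP _); last first.
  exact: le_trans (sqr_ge0 _) Mi.
(* The bound on squares also bounds absolute values, since k <= k^2 for every natural number k. *)
apply: le_trans Mi; rewrite -[leRHS]real_normK ?num_real // -intr_norm -natr_absz.
by rewrite -natrX ler_nat; case: absz => // k; rewrite -mulnn leq_pmulr.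
Qed.
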